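(* Let $m\ge 2$, let $p_1,\dots,p_m$ be $p$-values (random variables with values in $[0,1]$) for null hypotheses $H_{01},\dots,H_{0m}$, let $I_0\subseteq\{1,\dots,m\}$ be the set of indices of the true null hypotheses, and let $\mathbb{P}(p_i\le u)\le u$ for all $i\in I_0$ and $u\in[0,1]$. Let $\alpha>0$, and let $1\le s_1\le s_2\le\dots\le s_m\le m$ be a non-decreasing shape sequence. Assume that $p_1,\dots,p_m$ are positively dependent random variables, in the sense that $(p_1,\dots,p_m)$ is positively regression dependent on the subset $I_0$, and that non-negative weights $w_1,\dots,w_m$ are given. Then the step-up procedure with threshold sequence $t_r=s_r\alpha/m$ $(r=1,\dots,m)$ applied to $q_1,\dots,q_m$, where $q_i=p_i/w_i$ if $w_i>0$ and $q_i=1$ if $w_i=0$, satisfies $$\mathrm{pFDR}=\mathbb{E}\left[\frac{\mathit{FP}}{s_R}\,\mathbf{1}\{R>0\}\right]\le \frac{\alpha}{m}\sum_{i=1}^m w_i ,$$ where $R$ denotes the number of rejections.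
   Context: Let $q_{(1)}\le\dots\le q_{(m)}$ be the ordered values of $q_1,\dots,q_m$. The step-up procedure with non-decreasing threshold sequence $t_1\le\dots\le t_m$ applied to $q_1,\dots,q_m$ is defined by $R=\max\{r\in\{1,\dots,m\}: q_{(r)}\le t_r\}$, with $R=0$ if no such $r$ exists; it rejects no hypothesis if $R=0$, and if $R\ge1$ it rejects exactly the hypotheses $H_{0i}$ with $q_i\le t_R$ (there are exactly $R$ of them). $\mathit{FP}$ denotes the number of rejected hypotheses with index in $I_0$ (false positives). The penalized false discovery proportion is $\mathit{pFDP}=\mathit{FP}/s_R$ if $R\ge1$ and $0$ otherwise, and the penalized false discovery rate is $\mathrm{pFDR}=\mathbb{E}(\mathit{pFDP})$. The weights are deterministic (fixed a priori). Positive regression dependence on the subset $I_0$ (in the sense of Benjamini and Yekutieli): for every $i\in I_0$ and every measurable non-decreasing set $D\subseteq[0,1]^m$ (i.e. $x\in D$ and $y\ge x$ coordinatewise, $y\in[0,1]^m$, imply $y\in D$), the function $u\mapsto\mathbb{P}\big((p_1,\dots,p_m)\in D\mid p_i=u\big)$ is non-decreasing (has a non-decreasing version).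
   Formalization: Added assumption: if some true null hypothesis has weight w_i = 0, then t_m = s_m α/m < 1 (automatic for α < 1); without it the bound fails, e.g. for all w_i = 0, α = 1, s_r = r, all nulls true, p_i independent uniform: then q_i = 1 = t_m, and pFDR = 1 > 0. *)

(* Defs.v *)
From HB Require Import structures.
From mathcomp Require Import all_boot all_order all_algebra.
From mathcomp Require Import all_classical all_reals all_analysis.

Set Implicit Arguments.
Unset Strict Implicit.
Unset Printing Implicit Defensive.

Import Order.TTheory GRing.Theory Num.Theory.
Local Open Scope classical_set_scope.
Local Open Scope ring_scope.

(* Sequences written with ranks 1, ..., m in the mathematics (thresholds,
   shape sequence) are functions [nat -> R]; only their values at 1, ..., m
   matter. Hypotheses are indexed by ['I_m]. *)

Definition order_stat (R : realType) (m : nat) (q : 'I_m -> R) (r : nat) : R :=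
  nth 0 (sort <=%R [seq q i | i <- enum 'I_m]) r.-1.

(* The maximum over an empty range is 0. *)
Definition stepup_nrej (R : realType) (m : nat) (t : nat -> R)
    (q : 'I_m -> R) : nat :=
  \max_(1 <= r < m.+1 | order_stat q r <= t r) r.

Definition stepup_rejected (R : realType) (m : nat) (t : nat -> R)
    (q : 'I_m -> R) : {set 'I_m} :=
  if stepup_nrej t q == 0%N then finset.set0
  else [set i | q i <= t (stepup_nrej t q)]%SET.

Definition false_positives (R : realType) (m : nat) (I0 : {set 'I_m})
    (t : nat -> R) (q : 'I_m -> R) : nat :=
  #|stepup_rejected t q :&: I0|.

Definition pFDP (R : realType) (m : nat) (I0 : {set 'I_m}) (s t : nat -> R)
    (q : 'I_m -> R) : R :=
  if stepup_nrej t q == 0%N then 0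
  else (false_positives I0 t q)%:R / s (stepup_nrej t q).

Definition pFDR (d : measure_display) (T : measurableType d) (R : realType)
    (P : probability T R) (m : nat) (I0 : {set 'I_m}) (s t : nat -> R)
    (q : 'I_m -> T -> R) : \bar R :=
  'E_P[fun x => pFDP I0 s t (fun i => q i x)].

Definition weighted_pvalue (R : realType) (w p : R) : R :=
  if 0 < w then p / w else 1.

Definition shape_threshold (R : realType) (m : nat) (s : nat -> R) (alpha : R)
    (r : nat) : R :=
  s r * alpha / m%:R.

Definition unit_cube (R : realType) (m : nat) : set (m.-tuple R) :=
  [set x | forall i, 0 <= tnth x i <= 1].
Arguments unit_cube : clear implicits.

Definition nondecreasing_set (R : realType) (m : nat) (D : set (m.-tuple R)) :
    Prop :=
  D `<=` unit_cube R m /\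
  (forall x y, D x -> unit_cube R m y ->
    (forall i, tnth x i <= tnth y i) -> D y).

(* [f] is a version of u |-> P(E | X = u): f(X) is the conditional probability
   of E given the sigma-algebra generated by X. *)
Definition cond_prob_version (d : measure_display) (T : measurableType d)
    (R : realType) (P : probability T R) (E : set T) (X : T -> R)
    (f : R -> R) : Prop :=
  [/\ measurable_fun [set: R] f,
      P.-integrable [set: T] (fun x => (f (X x))%:E) &
      forall B : set R, measurable B ->
        P (E `&` X @^-1` B) = (\int[P]_(x in X @^-1` B) (f (X x))%:E)%E].

(* Positive regression dependence on the subset [I0]
   (Benjamini and Yekutieli). *)
Definition PRDS (d : measure_display) (T : measurableType d)
    (R : realType) (P : probability T R) (m : nat) (I0 : {set 'I_m})
    (p : 'I_m -> T -> R) : Prop :=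
  forall i, i \in I0 ->
  forall D : set (m.-tuple (measurableTypeR R)),
    measurable D -> nondecreasing_set D ->
  exists f : R -> R,
    cond_prob_version P [set x | D [tuple p j x | j < m]] (p i) f /\
    {in `[0, 1] &, {homo f : u v / u <= v}}.

(* Main.v *)
Require Import Defs.
From mathcomp Require Import all_boot all_order all_algebra.
From mathcomp Require Import all_classical all_reals all_analysis.
From mathcomp Require Import measurable_realfun lra.

Import Order.TTheory GRing.Theory Num.Theory.
Local Open Scope classical_set_scope.
Local Open Scope ring_scope.

(** By linearity the penalized false discovery rate is the sum, over the true
    nulls i and the ranks r, of P(R = r, q_i <= t_r) / s_r, and it is enough to
    bound the inner sum over r by K = alpha w_i / m for each i.

    If w_i = 0 then q_i = 1 exceeds all thresholds and the sum is 0. If w_i > 0,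
    then q_i <= t_r means p_i <= c_r with c_r = K s_r, and superuniformity
    gives P(p_i <= c_r) <= K s_r, that is, 1 / s_r <= K / P(p_i <= c_r). Hence
    the r-th term is at most
      K (P(R <= r | p_i <= c_r) - P(R <= r - 1 | p_i <= c_r)).
    The event R <= r is non-decreasing in the p-values, so positive regression
    dependence yields
      P(R <= r | p_i <= c_r) <= P(R <= r | p_i <= c_(r+1)),
    the passage from conditioning on p_i = u to conditioning on p_i <= u being
    [cond_prob_cross] and its application to R being [PRDS_stepup_cross]. The
    sum over r therefore telescopes to at most K ([telescope_ratio_le]).

    To apply the dependence hypothesis the event R <= r has to be a measurable
    non-decreasing subset of the unit cube. Both facts come from the description
    of R by counts of values below thresholds, [stepup_nrej_le]. *)

(** * Combinatorics of the step-up procedure *)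

(** Counting the values below u replaces sorting them. *)
Lemma order_stat_le {R : realType} {m : nat} (q : 'I_m -> R) (k : nat) (u : R) :
  (0 < k <= m)%N ->
  (order_stat q k <= u) = (k <= #|[set i | (q i <= u)%R]%SET|)%N.
Proof.
case: k => // k /= km; rewrite /order_stat /=.
set l := [seq q i | i <- enum 'I_m].
have sl : sorted <=%R (sort <=%R l) by apply: sort_sorted; exact: le_total.
have -> : #|[set i | q i <= u]%SET| = count (<= u) (sort <=%R l).
  rewrite cardsE cardE size_filter (permP (permEl (perm_sort _ l))) count_map.
  by rewrite enumT; apply: eq_count => i; rewrite !inE.
have szl : size (sort <=%R l) = m by rewrite size_sort size_map size_enum_ord.
apply/idP/idP => [h|]; last exact: nth_count_le.
rewrite leqNgt; apply/negP => lt.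
suff : u < nth 0 (sort <=%R l) k by rewrite ltNge h.
by apply: nth_count_gt; rewrite // szl km andbT.
Qed.

(** The maximal rank is at most r exactly when every larger rank k fails, and
    k fails when fewer than k of the q_i lie below t_k. Monotonicity and
    measurability of the number of rejections are read off from the right-hand
    side. *)
Lemma stepup_nrej_le {R : realType} {m : nat} (t : nat -> R) (q : 'I_m -> R)
    (r : nat) :
  (stepup_nrej t q <= r)%N =
  [forall k : 'I_m.+1, (r < k)%N ==> (#|[set i | (q i <= t k)%R]%SET| < k)%N].
Proof.
apply/bigmax_leqP_seq/forallP => [h k|h k].
  apply/implyP => rk; rewrite ltnNge; apply/negP => hk.
  have k0 : (0 < k <= m)%N by rewrite (leq_ltn_trans _ rk)//= -ltnS.
  have := h k; rewrite mem_index_iota ltnS order_stat_le// hk => /(_ k0 erefl).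
  by rewrite leqNgt rk.
rewrite mem_index_iota => /andP[k0 km]; rewrite order_stat_le ?k0 ?ltnS// => hk.
rewrite leqNgt; apply/negP => rk.
by have := h (Ordinal km); rewrite /= rk/= ltnNge hk.
Qed.

(** Raising the q_i can only lower the counts of values below a threshold. *)
Lemma stepup_nrej_anti {R : realType} {m : nat} (t : nat -> R)
    (q q' : 'I_m -> R) :
  (forall i, q i <= q' i) -> (stepup_nrej t q' <= stepup_nrej t q)%N.
Proof.
move=> qq'; rewrite stepup_nrej_le; apply/forallP => k; apply/implyP => Rk.
have := leqnn (stepup_nrej t q).
rewrite {1}stepup_nrej_le => /forallP/(_ k)/implyP/(_ Rk); apply: leq_ltn_trans.
by apply/subset_leq_card/fintype.subsetP => i; rewrite !inE; exact: le_trans.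
Qed.

Lemma stepup_nrej_max {R : realType} {m : nat} (t : nat -> R) (q : 'I_m -> R) :
  (stepup_nrej t q <= m)%N.
Proof.
by rewrite stepup_nrej_le; apply/forallP => k; rewrite ltnNge -ltnS ltn_ord.
Qed.

(** Splitting by the rejected true null and by the number of rejections makes
    the threshold and the penalty deterministic in each summand. The index is
    shifted: r : 'I_m stands for r.+1 rejections. *)
Lemma pFDP_sum {R : realType} {m : nat} (I0 : {set 'I_m}) (s t : nat -> R)
    (q : 'I_m -> R) :
  pFDP I0 s t q =
  \sum_(i in I0) \sum_(r < m)
    ((stepup_nrej t q == r.+1) && (q i <= t r.+1))%:R / s r.+1.
Proof.
rewrite /pFDP /false_positives /stepup_rejected.
have := stepup_nrej_max t q; case: (stepup_nrej t q) => [_|n nm].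
  by rewrite /= big1// => i _; rewrite big1// => r _; rewrite mul0r.
rewrite /= -sum1_card natr_sum mulr_suml.
rewrite (eq_bigl (fun i => (i \in I0) && (q i <= t n.+1))); last first.
  by move=> i; rewrite !inE andbC.
rewrite big_mkcondr; apply: eq_bigr => i _.
rewrite (bigD1 (Ordinal nm))//= eqxx /= big1 ?addr0.
  by case: ifP => // _; rewrite mul0r.
by move=> r; rewrite -val_eqE/= eqSS eq_sym => /negbTE ->; rewrite mul0r.
Qed.

(** * Measurability of the number of rejections *)

(** An event depending only on which of finitely many measurable events occur
    is a finite union of atoms of the algebra that they generate. *)
Lemma measurable_pattern {d : measure_display} {X : measurableType d}
    {J : finType} (A : J -> X -> bool) (Q : pred {set J}) :
  (forall i, measurable [set x | A i x]) ->
  measurable [set x | Q [set i | A i x]%SET].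
Proof.
move=> mA.
rewrite (_ : [set x | _] = \bigcup_(S in [set S | Q S])
    \bigcap_(i in [set: J]) (if i \in S then [set x | A i x]
                             else ~` [set x | A i x])); last first.
  apply/seteqP; split => x /=.
    move=> Qx; exists [set i | A i x]%SET => //= i _; rewrite inE.
    by case: ifPn => //= /negP.
  move=> [S /= QS AS]; rewrite (_ : finset.finset _ = S)//.
  apply/setP => i; rewrite inE; have := AS i Logic.I; case: ifP => //= _.
  by move=> /negP/negbTE.
apply: fin_bigcup_measurable => [|S _]; first exact: (@finite_finset {set J}).
 apply: fin_bigcap_measurable => [|i _]; first exact: finite_finset.
by case: ifP => // _; exact: measurableC.
Qed.

Lemma weighted_pvalue_le {R : realType} (w : R) :
  {homo weighted_pvalue w : p p' / p <= p'}.
Proof.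
move=> p p' pp'; rewrite /weighted_pvalue; case: ifP => // w0.
by rewrite ler_pM2r// invr_gt0.
Qed.

Lemma measurable_fun_weighted_pvalue {d : measure_display}
    {X : measurableType d} {R : realType} (w : R) (p : X -> R) :
  measurable_fun [set: X] p ->
  measurable_fun [set: X] (weighted_pvalue w \o p).
Proof.
move=> mp; rewrite /weighted_pvalue /comp; case: (0 < w).
  by apply: measurable_funM => //; exact: measurable_cst.
exact: measurable_cst.
Qed.

Lemma measurable_le_cst {d : measure_display} {X : measurableType d}
    {R : realType} (q : X -> R) (u : R) :
  measurable_fun [set: X] q -> measurable [set x | q x <= u].
Proof.
move=> mq; rewrite (_ : [set x | _] = [set: X] `&` q @^-1` [set` `]-oo, u]]).
  exact: mq.
by rewrite setTI; apply/seteqP; split => x /=; rewrite in_itv.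
Qed.

Lemma measurable_stepup_nrej_le {d : measure_display} {X : measurableType d}
    {R : realType} {m : nat} (t : nat -> R) (q : 'I_m -> X -> R) (r : nat) :
  (forall i, measurable_fun [set: X] (q i)) ->
  measurable [set x | (stepup_nrej t (q ^~ x) <= r)%N].
Proof.
move=> mq.
(* The relevant events are q_i <= t_k, indexed by the pairs (i, k). *)
pose Q (S : {set 'I_m * 'I_m.+1}) := [forall k : 'I_m.+1,
  (r < k)%N ==> (#|[set i | (i, k) \in S]%SET| < k)%N].
rewrite (_ : [set x | _] =
    [set x | Q [set ik : 'I_m * 'I_m.+1 | q ik.1 x <= t ik.2]%SET]); last first.
  apply/funext => x; rewrite /= stepup_nrej_le /Q; congr is_true.
  apply: eq_forallb => k; congr (_ ==> (_ < _)%N).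
  by apply: eq_card => i; rewrite !inE.
by apply: measurable_pattern => -[i k] /=; exact: measurable_le_cst.
Qed.

Lemma measurable_stepup_nrej_eq {d : measure_display} {X : measurableType d}
    {R : realType} {m : nat} (t : nat -> R) (q : 'I_m -> X -> R) (r : nat) :
  (forall i, measurable_fun [set: X] (q i)) ->
  measurable [set x | stepup_nrej t (q ^~ x) = r.+1].
Proof.
move=> mq.
rewrite (_ : [set x | _] = [set x | (stepup_nrej t (q ^~ x) <= r.+1)%N] `\`
                           [set x | (stepup_nrej t (q ^~ x) <= r)%N]).
  by apply: measurableD; exact: measurable_stepup_nrej_le.
apply/seteqP; split=> x /=.
  by move=> ->; split=> //; rewrite ltnn.
by move=> [Nr /negP]; rewrite -ltnNge => rN; apply/eqP; rewrite eqn_leq Nr.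
Qed.

(** * Consequences of positive regression dependence *)

(** Averaging the monotone version f over {X <= c} gives at most f c, and over
    {c < X <= c'} at least f c; conditioning on the union mixes the first mean
    with a larger one, whence P(E | X <= c) <= P(E | X <= c'). Clearing the
    denominators avoids the case of a null conditioning event. *)
Lemma cond_prob_cross {d : measure_display} {T : measurableType d}
    {R : realType} (P : probability T R) (E : set T) (X : {RV P >-> R})
    (f : R -> R) (c c' : R) :
  measurable E -> (forall x, 0 <= X x <= 1) ->
  cond_prob_version P E X f ->
  {in `[0, 1] &, {homo f : u v / u <= v}} ->
  0 <= c -> c <= c' ->
  (P (E `&` [set x | (X x <= c)%R]) * P [set x | (X x <= c')%R] <=
   P (E `&` [set x | (X x <= c')%R]) * P [set x | (X x <= c)%R])%E.
Proof.
move=> mE X01 [mf fint fE] fmono c0 cc'.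
have mX B : measurable B -> measurable (X @^-1` B).
  by move=> mB; rewrite -[_ @^-1` _]setTI; exact: measurable_funP.
(* The version f is monotone on [0, 1] only; from 1 on both events are sure. *)
have [c1|c1] := leP 1 c.
  have alltrue u : 1 <= u -> [set x | X x <= u] = [set: T].
    move=> u1; apply/seteqP; split=> x //= _.
    by have /andP[_ /le_trans->] := X01 x.
  by rewrite !alltrue// (le_trans c1).
have cI : c \in `[0, 1] by rewrite in_itv/= c0 ltW.
have XI x : X x \in `[0, 1] by rewrite in_itv/= X01.
pose A := X @^-1` `]-oo, c]; pose B := X @^-1` `]c, c'].
have mA : measurable A by apply: mX.
have mB : measurable B by apply: mX.
have EA : [set x | X x <= c] = A by apply/seteqP; split=> x; rewrite /A/= in_itv.
have EB : [set x | X x <= c'] = A `|` B.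
  apply/seteqP; split=> x; rewrite /A /B/= !in_itv/=.
    by move=> ->; rewrite andbT; case: (leP (X x) c); [left|right].
  by case=> [/le_trans->//|/andP[]].
have dAB : A `&` B = set0.
  apply/seteqP; split=> x //= [/=]; rewrite /A /B /= !in_itv/= => + /andP[+ _].
  by move=> /le_lt_trans/[apply]; rewrite ltxx.
have intf D : measurable D -> P.-integrable D (fun x => (f (X x))%:E).
  by move=> mD; apply: integrableS fint.
have intc D : measurable D -> P.-integrable D (cst (f c)%:E).
  by move=> mD; apply: finite_measure_integrable_cst.
have leA : (P (E `&` A) <= (f c)%:E * P A)%E.
  rewrite fE// -integral_cst//; apply: le_integral => //; [exact: intf|exact: intc|].
  move=> x; rewrite inE /A/= in_itv/= => xc; rewrite lee_fin.
  exact: fmono.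
have leB : ((f c)%:E * P B <= P (E `&` B))%E.
  rewrite fE// -integral_cst//; apply: le_integral => //; [exact: intc|exact: intf|].
  move=> x; rewrite inE /B/= in_itv/= => /andP[xc _]; rewrite lee_fin.
  exact: fmono (ltW xc).
have PU C D : measurable C -> measurable D -> C `&` D = set0 ->
    (P (C `|` D) = P C + P D)%E by exact: measureU.
rewrite EA EB setIUr !PU//; last 3 first.
- exact: measurableI.
- exact: measurableI.
- by rewrite setIACA setIid dAB setI0.
have fn D : measurable D -> P D \is a fin_num.
  by move=> mD; exact: fin_num_measure.
have [mEA mEB] : measurable (E `&` A) /\ measurable (E `&` B).
  by split; exact: measurableI.
move: leA leB.
rewrite -(fineK (fn _ mA)) -(fineK (fn _ mB)) -(fineK (fn _ mEA)) -(fineK (fn _ mEB)).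
rewrite -!EFinD -!EFinM !lee_fin => leA leB.
have A0 : 0 <= fine (P A) by exact: fine_ge0.
have B0 : 0 <= fine (P B) by exact: fine_ge0.
nra.
Qed.

(** Having few rejections is a non-decreasing event of the p-values, because
    the number of rejections decreases when they grow. Positive regression
    dependence speaks of subsets of the unit cube, so the event is first
    described by its trace on the cube, which contains all the p-values. *)
Lemma PRDS_stepup_cross {d : measure_display} {T : measurableType d}
    {R : realType} (P : probability T R) {m : nat} (I0 : {set 'I_m})
    (p : 'I_m -> {RV P >-> R}) (w : 'I_m -> R) (t : nat -> R) (i : 'I_m)
    (r : nat) (c c' : R)
    (E := [set x |
      (stepup_nrej t (fun j => weighted_pvalue (w j) (p j x)) <= r)%N]) :
  (forall j x, 0 <= p j x <= 1) -> PRDS P I0 p -> i \in I0 ->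
  0 <= c -> c <= c' ->
  (P (E `&` [set x | (p i x <= c)%R]) * P [set x | (p i x <= c')%R] <=
   P (E `&` [set x | (p i x <= c')%R]) * P [set x | (p i x <= c)%R])%E.
Proof.
move=> p01 prds iI0 c0 cc'.
pose q j (y : m.-tuple (measurableTypeR R)) := weighted_pvalue (w j) (tnth y j).
pose D : set (m.-tuple (measurableTypeR R)) :=
  unit_cube R m `&` [set y | (stepup_nrej t (q ^~ y) <= r)%N].
have mD : measurable D.
  apply: measurableI; last first.
    apply: measurable_stepup_nrej_le => j.
    apply: (@measurable_fun_weighted_pvalue _ _ _ _ (fun y => tnth y j)).
    exact: measurable_tnth.
  rewrite (_ : unit_cube R m = \bigcap_(j in [set: 'I_m])
      ((fun y : m.-tuple (measurableTypeR R) => tnth y j) @^-1` `[0, 1])).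
    apply: fin_bigcap_measurable => [|j _]; first exact: finite_finset.
    have mj := @measurable_tnth _ (measurableTypeR R) m j.
    rewrite -[_ @^-1` _]setTI; apply: mj => //.
  apply/seteqP; split => [y y01 j _|y y01 j]; first by rewrite /= in_itv/= y01.
  by have := y01 j Logic.I; rewrite /= in_itv.
have ndD : nondecreasing_set D.
  split=> [y []//|x y [_ Nx] y01 xy]; split => //=.
  apply: leq_trans Nx; apply: stepup_nrej_anti => j; exact: weighted_pvalue_le.
have [f [fE fmono]] := prds i iI0 D mD ndD.
have ED : [set x | D [tuple p j x | j < m]] = E.
  apply/funext => x; rewrite /D /E /=; apply/propext.
  have -> : q ^~ [tuple p j x | j < m] =
      (fun j => weighted_pvalue (w j) (p j x)).
    by apply/funext => j; rewrite /q tnth_mktuple.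
  by split=> [[]//|Nx]; split=> // j; rewrite tnth_mktuple p01.
have mE : measurable E.
  apply: measurable_stepup_nrej_le => j.
  exact: measurable_fun_weighted_pvalue.
by move: fE; rewrite ED => fE; exact: cond_prob_cross fE fmono c0 cc'.
Qed.

(** * Bound on the penalized false discovery rate *)

(** Read F r as P(p <= c_r), a r and b r as the probabilities of that event
    together with R <= r and with R <= r - 1. Since 1 / s r <= K / F r, each
    summand is at most K (a r / F r - b r / F r); the cross condition says
    a r / F r <= b (r + 1) / F (r + 1), so these differences telescope up to
    K (a / F) at the last index, which is at most K. Where F vanishes so do a
    and b, and the convention x / 0 = 0 keeps the argument valid. *)
Lemma telescope_ratio_le {R : realFieldType} (m : nat) (K : R)
    (a b F s : nat -> R) :
  0 <= K ->
  (forall r, (r < m)%N -> 0 < s r) ->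
  (forall r, (r < m)%N -> F r <= K * s r) ->
  (forall r, (r < m)%N -> 0 <= b r <= a r) ->
  (forall r, (r < m)%N -> a r <= F r) ->
  (forall r, (r.+1 < m)%N -> F r <= F r.+1) ->
  (forall r, (r.+1 < m)%N -> a r * F r.+1 <= b r.+1 * F r) ->
  \sum_(r < m) (a r - b r) / s r <= K.
Proof.
move=> K0 s0 FK ba aF Fle cross.
have a0 r : (r < m)%N -> 0 <= a r by move=> /ba/andP[]; exact: le_trans.
have F0 r : (r < m)%N -> 0 <= F r by move=> rm; exact: le_trans (a0 _ rm) (aF _ rm).
have step r : (r < m)%N -> (a r - b r) / s r <= K * (a r / F r - b r / F r).
  move=> rm; have /andP[b0 bar] := ba _ rm.
  have := F0 _ rm; rewrite le_eqVlt => /predU1P[Fr0|Fr].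
    have /eqP ar0 : a r == 0 by rewrite eq_le a0// Fr0 aF.
    have /eqP br0 : b r == 0 by rewrite eq_le b0 -ar0 bar.
    by rewrite ar0 br0 !mul0r subrr mul0r mulr0.
  rewrite -mulrBl mulrCA ler_wpM2l ?subr_ge0//.
  by rewrite ler_pdivlMr// mulrC ler_pdivrMr ?s0// FK.
suff main n : (n < m)%N ->
    \sum_(r < n.+1) (a r - b r) / s r <= K * (a n / F n).
  case: m => [|m] in s0 FK ba aF Fle cross a0 F0 step main *.
    by rewrite big_ord0.
  apply: le_trans (main m (leqnn _)) _; rewrite ler_piMr//.
  have := F0 m (leqnn _); rewrite le_eqVlt => /predU1P[<-|Fm].
    by rewrite invr0 mulr0.
  by rewrite ler_pdivrMr// mul1r aF.
elim: n => [|n IHn] nm.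
  rewrite big_ord1; apply: le_trans (step _ nm) _; rewrite ler_wpM2l//.
  rewrite gerBl divr_ge0 ?F0//; by have /andP[] := ba _ nm.
rewrite big_ord_recr/=; apply: le_trans (lerD (IHn (ltnW nm)) (step _ nm)) _.
rewrite -mulrDr ler_wpM2l// addrCA gerDl subr_le0.
have := F0 _ (ltnW nm); rewrite le_eqVlt => /predU1P[<-|Fn].
  by rewrite invr0 mulr0 divr_ge0 ?F0//; have /andP[] := ba _ nm.
have Fn1 : 0 < F n.+1 by exact: lt_le_trans Fn (Fle _ nm).
by rewrite ler_pdivrMr// mulrAC ler_pdivlMr// cross.
Qed.

(** The contribution of one true null with positive weight, K being
    alpha w_i / m: rejection among r rejections means p_i <= K s_r, and the
    superuniformity of p_i makes the probability of {p_i <= K s_r} at most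
    K s_r, which cancels the penalty. *)
Lemma stepup_rejection_bound {d : measure_display} {T : measurableType d}
    {R : realType} (P : probability T R) {m : nat} (I0 : {set 'I_m})
    (p : 'I_m -> {RV P >-> R}) (w : 'I_m -> R) (s : nat -> R) (K : R)
    (t : nat -> R) (i : 'I_m)
    (N := fun x => stepup_nrej t (fun j => weighted_pvalue (w j) (p j x))) :
  (forall j x, 0 <= p j x <= 1) -> PRDS P I0 p -> i \in I0 ->
  (forall u, 0 <= u -> (P [set x | (p i x <= u)%R] <= u%:E)%E) ->
  (forall r, (0 < r <= m)%N -> 0 < s r) ->
  (forall r r', (0 < r)%N -> (r <= r' <= m)%N -> s r <= s r') ->
  0 <= K ->
  (\sum_(r < m) ((s r.+1)^-1)%:E *
     P [set x | N x = r.+1 /\ (p i x <= K * s r.+1)%R] <= K%:E)%E.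
Proof.
move=> p01 prds iI0 pu s0 smono K0.
have mN r : measurable [set x | (N x <= r)%N].
  apply: measurable_stepup_nrej_le => j.
  exact: measurable_fun_weighted_pvalue.
have mp c : measurable [set x | p i x <= c] by exact: measurable_le_cst.
have fn D : measurable D -> P D \is a fin_num.
  by move=> mD; exact: fin_num_measure.
have le_fine D D' : measurable D -> measurable D' -> D `<=` D' ->
    fine (P D) <= fine (P D').
  move=> mD mD' DD'; apply: fine_le; [exact: fn|exact: fn|].
  by apply: le_measure => //; rewrite inE.
pose F r := fine (P [set x | p i x <= K * s r.+1]).
pose a r := fine (P ([set x | (N x <= r.+1)%N] `&` [set x | p i x <= K * s r.+1])).
pose b r := fine (P ([set x | (N x <= r)%N] `&` [set x | p i x <= K * s r.+1])).
rewrite (_ : (\sum_(r < m) _)%E = (\sum_(r < m) (a r - b r) / s r.+1)%:E).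
  rewrite lee_fin; apply: (@telescope_ratio_le _ _ _ a b F (fun r => s r.+1)).
  - exact: K0.
  - by move=> r rm; exact: s0.
  - move=> r rm; rewrite -lee_fin /F fineK; last exact/fn.
    by apply: pu; rewrite mulr_ge0// ltW// s0.
  - move=> r rm; rewrite fine_ge0//=; apply: le_fine.
    + exact: measurableI.
    + exact: measurableI.
    + by apply: setSI => x /= /leq_trans; apply.
  - by move=> r rm; apply: le_fine => //; exact: measurableI.
  - move=> r rm; apply: le_fine => // x /= /le_trans; apply.
    by rewrite ler_wpM2l// smono// leqnSn.
  - move=> r rm; rewrite -lee_fin !EFinM !fineK; try exact/fn/measurableI; try exact/fn.
    apply: (PRDS_stepup_cross P I0 p w t) => //.
      by rewrite mulr_ge0// ltW// s0//= ltnW.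
    by rewrite ler_wpM2l// smono// leqnSn.
rewrite -sumEFin; apply: eq_bigr => r _; rewrite [(_ / _)%R]mulrC EFinM; congr (_ * _)%E.
pose Y := [set x | p i x <= K * s r.+1].
have mA' k : measurable ([set x | (N x <= k)%N] `&` Y).
  by apply: measurableI; [exact: mN|exact: mp].
rewrite EFinB !fineK; try exact/fn.
rewrite [X in P X = _](_ : _ = ([set x | (N x <= r.+1)%N] `&` Y) `\`
    ([set x | (N x <= r)%N] `&` Y)).
  rewrite measureD//; last exact: (le_lt_trans (probability_le1 P _)) (ltry 1).
  congr (_ - P _)%E; rewrite setIACA setIid; congr (_ `&` _).
  by apply/seteqP; split=> [x []//|x /= Nr]; split=> //; exact: leqW.
apply/seteqP; split=> [x /= [-> Yx]|x /= [[Nr Yx] nN]].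
  by split=> // -[]; rewrite ltnn.
split=> //; apply/eqP; rewrite eqn_leq Nr /= ltnNge; apply/negP => Nr'.
exact: nN.
Qed.

Lemma pFDR_sum {d : measure_display} {T : measurableType d} {R : realType}
    (P : probability T R) {m : nat} (I0 : {set 'I_m}) (s t : nat -> R)
    (q : 'I_m -> T -> R) :
  (forall i, measurable_fun [set: T] (q i)) ->
  (forall r, (0 < r <= m)%N -> 0 < s r) ->
  pFDR P I0 s t q =
  (\sum_(i in I0) \sum_(r < m) ((s r.+1)^-1)%:E *
     P [set x | stepup_nrej t (q ^~ x) = r.+1 /\ (q i x <= t r.+1)%R])%E.
Proof.
move=> mq s0; rewrite /pFDR unlock.
pose E i (r : 'I_m) :=
  [set x | stepup_nrej t (q ^~ x) = r.+1 /\ q i x <= t r.+1].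
have mE i r : measurable (E i r).
  rewrite (_ : E i r =
      [set x | stepup_nrej t (q ^~ x) = r.+1] `&` [set x | q i x <= t r.+1]) //.
  apply: measurableI; first exact: measurable_stepup_nrej_eq.
  exact: measurable_le_cst.
have sV0 (r : 'I_m) : 0 <= (s r.+1)^-1 by rewrite invr_ge0 ltW// s0/=.
have mterm i (r : 'I_m) : measurable_fun [set: T]
    (fun x => ((s r.+1)^-1)%:E * (\1_(E i r) x)%:E)%E.
  by apply: measurable_funeM; apply/measurable_EFinP; exact: measurable_indic.
have term0 i (r : 'I_m) x : (0 <= ((s r.+1)^-1)%:E * (\1_(E i r) x)%:E)%E.
  by rewrite -EFinM lee_fin mulr_ge0.
(* The sum over I0 is turned into a sum over its enumeration, since
   integration is exchanged below with unconditional sums over a sequence. *)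
under eq_integral => x _.
  rewrite pFDP_sum -sumEFin.
  under eq_bigr => i _.
    rewrite -sumEFin.
    under eq_bigr => r _.
      rewrite mulrC (_ : _%:R = \1_(E i r) x); last first.
        rewrite indicE; congr (nat_of_bool _)%:R.
        by apply/andP/idP => [[/eqP ? ?]|]; rewrite inE => // -[/eqP].
      rewrite EFinM; over.
    over.
  rewrite -big_enum /=; over.
rewrite -[RHS]big_enum /= ge0_integral_sum//; last 2 first.
- by move=> i; exact: emeasurable_sum.
- by move=> i x _; exact: sume_ge0.
apply: eq_bigr => i _; rewrite ge0_integral_sum//.
apply: eq_bigr => r _; rewrite ge0_integralZl_EFin//.
  by rewrite integral_indic// setIT.
by apply/measurable_EFinP; exact: measurable_indic.
Qed.

Theorem proposition4p2
    (d : measure_display) (T : measurableType d) (R : realType)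
    (P : probability T R)
    (m : nat) (hm : (2 <= m)%N)
    (I0 : {set 'I_m})
    (p : 'I_m -> {RV P >-> R})
    (p01 : forall i x, 0 <= p i x <= 1)
    (psuperunif : forall i, i \in I0 -> forall u : R, 0 <= u <= 1 ->
      (P [set x | (p i x <= u)%R] <= u%:E)%E)
    (alpha : R) (halpha : 0 < alpha)
    (s : nat -> R)
    (s_ge1 : 1 <= s 1%N)
    (s_ndecr : forall r r' : nat, (1 <= r)%N -> (r <= r')%N -> (r' <= m)%N ->
      s r <= s r')
    (s_lem : s m <= m%:R)
    (p_prds : PRDS P I0 p)
    (w : 'I_m -> R) (w_ge0 : forall i, 0 <= w i)
    (* the placeholder value q_i = 1 lies above every threshold; without this
       the inequality fails, e.g. for w = 0, alpha = 1 and s_r = r *)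
    (w0_threshold : forall i, i \in I0 -> w i = 0 ->
      shape_threshold m s alpha m < 1) :
  (pFDR P I0 s (shape_threshold m s alpha)
     (fun i x => weighted_pvalue (w i) (p i x))
   <= (alpha / m%:R * \sum_(i < m) w i)%:E)%E.
Proof.
have am0 : 0 <= alpha / m%:R by rewrite divr_ge0// ltW.
have s0 r : (0 < r <= m)%N -> 0 < s r.
  move=> /andP[r0 rm].
  by apply: lt_le_trans ltr01 (le_trans s_ge1 _); exact: s_ndecr.
rewrite pFDR_sum//; last by move=> i; exact: measurable_fun_weighted_pvalue.
apply: (@le_trans _ _ (\sum_(i in I0) (alpha / m%:R * w i)%:E)%E); last first.
  rewrite sumEFin lee_fin mulr_sumr big_mkcond/=; apply: ler_sum => i _.
  by case: ifP => // _; rewrite mulr_ge0.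
apply: lee_sum => i iI0.
have := w_ge0 i; rewrite le_eqVlt => /predU1P[wi0|wi0].
  (* Here q_i = 1 > t_m >= t_r for every rank r, so i is never rejected. *)
  rewrite big1 => [|r _]; first by rewrite lee_fin -wi0 mulr0.
  rewrite [X in P X](_ : _ = set0) ?measure0 ?mule0//.
  apply/seteqP; split=> x //= [_]; rewrite /weighted_pvalue -wi0 ltxx.
  apply/negP; rewrite -ltNge; apply: le_lt_trans (w0_threshold i iI0 _) => //.
  rewrite /shape_threshold -!mulrA; apply: ler_wpM2r => //; exact: s_ndecr.
under eq_bigr => r _.
  rewrite [X in P X](_ : _ = [set x |
      stepup_nrej (shape_threshold m s alpha)
        (fun j => weighted_pvalue (w j) (p j x)) = r.+1 /\
      p i x <= alpha / m%:R * w i * s r.+1]); last first.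
    apply/funext => x; congr (_ /\ is_true _).
    rewrite /weighted_pvalue wi0 ler_pdivrMr// /shape_threshold.
    by congr (_ <= _); rewrite -!mulrA; lra.
  over.
apply: (stepup_rejection_bound P I0 p w s) => //; first last.
- by rewrite mulr_ge0.
- by move=> r r' r0 /andP[rr' r'm]; exact: s_ndecr.
move=> u u0; have [u1|u1] := leP u 1; first by apply: psuperunif; rewrite // u0.
apply: le_trans (probability_le1 P _) _; first exact: measurable_le_cst.
by rewrite lee_fin ltW.
Qed.
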